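(* Let $(X,d_X,\mu,T)$ and $(Y,d_Y,\nu,S)$ be compact metric measure-preserving systems with anchor sequences $(a_r)$ dense in $\operatorname{supp}\mu$ and $(b_r)$ dense in $\operatorname{supp}\nu$, and fix $p\ge1$. Then $\widetilde{\mathrm{Dep}}_{n,m,R,p}(X,Y)=0$ for all $n,m,R\ge1$ if and only if the systems are disjoint, i.e. $\mathcal J(T,S)=\{\mu\otimes\nu\}$.
   Context: A compact metric measure-preserving system $(X,d_X,\mu,T)$: $(X,d_X)$ compact metric, $\mu$ Borel probability, $T$ Borel with $T_\#\mu=\mu$. $\mathcal J(T,S)$: Borel probability measures on $X\times Y$ with marginals $\mu,\nu$ invariant under $T\times S$. For $z_i=(x_i,y_i)$, $\mathcal D^X_{n,m}=(d_X(T^ax_i,T^bx_j))_{1\le i,j\le n,0\le a,b<m}$, $\widetilde{\mathcal D}^X_{n,m,R}=(\mathcal D^X_{n,m},(d_X(T^ax_i,a_r))_{1\le i\le n,0\le a<m,1\le r\le R})$, and $\widetilde{\mathcal D}^Y_{n,m,R}$ analogously with $d_Y,S,b_r$; $\widetilde\Phi_{n,m,R}(\lambda)=\mathrm{Law}_{\lambda^{\otimes n}}(\widetilde{\mathcal D}^X_{n,m,R},\widetilde{\mathcal D}^Y_{n,m,R})$. $W_p$ is the $p$-Wasserstein distance on probability measures on the finite array cube with a fixed product Euclidean metric, and $\widetilde{\mathrm{Dep}}_{n,m,R,p}(X,Y)=\sup_{\lambda\in\mathcal J(T,S)}W_p(\widetilde\Phi_{n,m,R}(\lambda),\widetilde\Phi_{n,m,R}(\mu\otimes\nu))$.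 *)

(* Defs.v *)
From HB Require Import structures.
From mathcomp Require Import all_boot all_order all_algebra.
From mathcomp Require Import all_classical all_reals all_analysis.


Unset Strict Implicit.
Unset Printing Implicit Defensive.

Import Order.TTheory GRing.Theory Num.Theory.
Import numFieldNormedType.Exports.

Local Open Scope classical_set_scope.
Local Open Scope ring_scope.

Section metric_defs.
Context {R : realType} {d : measure_display} {X : measurableType d}.
Variable dist : X -> X -> R.

Definition is_metric :=
  [/\ (forall x y, 0 <= dist x y),
      (forall x y, dist x y = 0 <-> x = y),
      (forall x y, dist x y = dist y x) &
      (forall x y z, dist x z <= dist x y + dist y z)].

Definition mopen (U : set X) :=
  forall x, U x -> exists2 e : R, 0 < e & forall y, dist x y < e -> U y.

Definition mcompact :=
  forall (I : Type) (U : I -> set X), (forall i, mopen (U i)) ->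
    \bigcup_i U i = setT ->
    exists2 F : set I, finite_set F & \bigcup_(i in F) U i = setT.

Definition borel_sigma :=
  forall A : set X, measurable A <-> <<s [set U | mopen U] >> A.

Definition compact_metric_borel := [/\ is_metric, mcompact & borel_sigma].

Definition msupp (mu : set X -> \bar R) : set X :=
  [set x | forall e : R, 0 < e -> (0 < mu [set y | (dist x y < e)%R])%E].

Definition anchors_dense (mu : set X -> \bar R) (a : nat -> X) :=
  (forall r, msupp mu (a r)) /\
  (forall x, msupp mu x -> forall e : R, 0 < e -> exists r, dist x (a r) < e).

End metric_defs.

Definition mpreserving {R : realType} {d} {X : measurableType d}
    (mu : set X -> \bar R) (T : X -> X) :=
  measurable_fun setT T /\
  forall A : set X, measurable A -> mu (T @^-1` A) = mu A.

Definition joining {R : realType} {dx dy} {X : measurableType dx}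
    {Y : measurableType dy} (mu : set X -> \bar R) (nu : set Y -> \bar R)
    (T : X -> X) (S : Y -> Y) (lam : set (X * Y) -> \bar R) :=
  [/\ (forall A : set X, measurable A -> lam (A `*` setT) = mu A),
      (forall B : set Y, measurable B -> lam (setT `*` B) = nu B) &
      (forall C : set (X * Y), measurable C ->
          lam ((fun z => (T z.1, S z.2)) @^-1` C) = lam C)].

(* n-fold product measure lam^{(x)n} on n.-tuple T, defined by iterated *)
(* integration of sections (standard construction of the product of     *)
(* probability measures).                                              *)
Section iprod.
Context {R : realType} {d : measure_display} {T : measurableType d}.
Variable lam : {measure set T -> \bar R}.

Fixpoint iprod (n : nat) : set (n.-tuple T) -> \bar R :=
  match n return set (n.-tuple T) -> \bar R with
  | 0 => fun A => if `[< A [tuple] >] then 1%E else 0%E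
  | k.+1 => fun A =>
      (\int[lam]_x (@iprod k [set t : k.-tuple T | A [tuple of x :: t]]))%E
  end.
End iprod.

(* index set of one array  D~_{n,m,R} :
   (i,j,a,b) for the D_{n,m} block, (i,a,r) for the anchor block *)
Definition arr_idx (n m R : nat) : finType :=
  (('I_n * 'I_n * 'I_m * 'I_m) + ('I_n * 'I_m * 'I_R))%type.

Definition pair_idx (n m R : nat) : finType :=
  (arr_idx n m R + arr_idx n m R)%type.

(* the finite array cube is a subset of R^N with N = #|pair_idx n m R|,
   coordinates listed along enum_val *)
Definition cube (K : realType) (n m R : nat) := (#|pair_idx n m R|).-tuple K.

Definition arr_entry {K : realType} {A : Type} (dA : A -> A -> K) (TA : A -> A)
    (anc : nat -> A) n m R (xs : 'I_n -> A) (k : arr_idx n m R) : K :=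
  match k with
  | inl (i, j, a, b) => dA (iter a TA (xs i)) (iter b TA (xs j))
  | inr (i, a, r) => dA (iter a TA (xs i)) (anc r)
  end.

Definition Dtilde {K : realType} {dx dy} {X : measurableType dx}
    {Y : measurableType dy} (dX : X -> X -> K) (dY : Y -> Y -> K)
    (T : X -> X) (S : Y -> Y) (a : nat -> X) (b : nat -> Y) (n m R : nat)
    (z : n.-tuple (X * Y)) : cube K n m R :=
  [tuple
     match enum_val k with
     | inl kx => arr_entry dX T a n m R (fun i => (tnth z i).1) kx
     | inr ky => arr_entry dY S b n m R (fun i => (tnth z i).2) ky
     end
   | k < #|pair_idx n m R|].

Definition Phi {K : realType} {dx dy} {X : measurableType dx}
    {Y : measurableType dy} (dX : X -> X -> K) (dY : Y -> Y -> K)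
    (T : X -> X) (S : Y -> Y) (a : nat -> X) (b : nat -> Y) (n m R : nat)
    (lam : {measure set (X * Y) -> \bar K}) : set (cube K n m R) -> \bar K :=
  fun A => @iprod _ _ _ lam n (Dtilde dX dY T S a b n m R @^-1` A).

Definition euclid {K : realType} {N : nat} (x y : N.-tuple K) : K :=
  Num.sqrt (\sum_(k < N) (tnth x k - tnth y k) ^+ 2).

Definition coupling {K : realType} {N : nat} (P Q : set (N.-tuple K) -> \bar K)
    (pi : {measure set (N.-tuple K * N.-tuple K) -> \bar K}) :=
  (forall A : set (N.-tuple K), measurable A -> pi (A `*` setT) = P A) /\
  (forall B : set (N.-tuple K), measurable B -> pi (setT `*` B) = Q B).

Definition Wasserstein {K : realType} {N : nat} (p : K)
    (P Q : set (N.-tuple K) -> \bar K) : \bar K :=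
  poweR (ereal_inf [set (\int[pi]_z (powR (euclid z.1 z.2) p)%:E)%E
                    | pi in [set pi | coupling P Q pi]]) p^-1.

Definition Dep {K : realType} {dx dy} {X : measurableType dx}
    {Y : measurableType dy} (dX : X -> X -> K) (dY : Y -> Y -> K)
    (mu : probability X K) (nu : probability Y K)
    (T : X -> X) (S : Y -> Y) (a : nat -> X) (b : nat -> Y)
    (n m R : nat) (p : K) : \bar K :=
  ereal_sup [set Wasserstein p (Phi dX dY T S a b n m R lam)
                               (Phi dX dY T S a b n m R (mu \x nu)%E)
            | lam in [set lam : {measure set (X * Y) -> \bar K} | joining mu nu T S lam]].

(* disjointness: J(T,S) = {mu (x) nu} (measures identified by their values
   on measurable sets) *)
Definition disjoint_systems {K : realType} {dx dy} {X : measurableType dx}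
    {Y : measurableType dy} (mu : probability X K) (nu : probability Y K)
    (T : X -> X) (S : Y -> Y) :=
  joining mu nu T S (mu \x nu)%E /\
  forall lam : {measure set (X * Y) -> \bar K}, joining mu nu T S lam ->
    forall C : set (X * Y), measurable C -> lam C = (mu \x nu)%E C.

(* Main.v *)
(* Only [n = m = 1] is needed for the forward direction. Up to null sets, an open
   set is the increasing union of finite unions of anchor balls, because the
   anchors are dense in the support and the complement of the support is null.
   The finite unions, with radii shrunk by a margin [delta], are read off from
   the anchor distances, and a zero Wasserstein distance gives couplings that
   move arbitrarily little mass over a distance [delta]. Hence two joinings at
   zero distance agree on rectangles of open sets, and therefore everywhere.

   For the converse the iterated set function [iprod] has to be shown to agree
   with a probability measure, and the arrays to depend measurably on the points,
   so that the diagonal coupling is available. *)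

Require Import Defs.
From HB Require Import structures.
From mathcomp Require Import all_boot all_order all_algebra.
From mathcomp Require Import all_classical all_reals all_analysis.
From mathcomp Require Import measurable_realfun lra.

Import Order.TTheory GRing.Theory Num.Theory.
Local Open Scope classical_set_scope.
Local Open Scope ring_scope.

(** * Compact metric spaces, supports and anchors *)

Lemma exists_natSinv_lt {K : realType} {e : K} :
  0 < e -> exists n : nat, n.+1%:R^-1 < e.
Proof.
move=> e0; have [n _ /(_ n (leqnn n)) ne] := near_infty_natSinv_lt (PosNum e0).
by exists n.
Qed.

Section compact_metric.
Context (K : realType) (d : measure_display) (X : measurableType d).
Variable dist : X -> X -> K.
Hypothesis Hdist : compact_metric_borel dist.

Let dist_sym x y : dist x y = dist y x.
Proof. by have [[_ _ + _] _ _] := Hdist; exact. Qed.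

Let dist_tri x y z : dist x z <= dist x y + dist y z.
Proof. by have [[_ _ _ +] _ _] := Hdist; exact. Qed.

Lemma dist_self x : dist x x = 0.
Proof. by have [[_ + _ _] _ _] := Hdist => /(_ x x)[_]; exact. Qed.

Lemma mopen_ball c (e : K) : mopen dist [set x | dist x c < e].
Proof.
move=> x /= xce; exists (e - dist x c); first by rewrite subr_gt0.
by move=> y xy; have := dist_tri y x c; rewrite (dist_sym y x); lra.
Qed.

Lemma mopen_measurable U : mopen dist U -> measurable U.
Proof.
have [_ _ borel] := Hdist.
by move=> oU; apply/borel; exact: sub_sigma_algebra.
Qed.

Lemma measurable_dball c (e : K) : measurable [set x | dist x c < e].
Proof. exact/mopen_measurable/mopen_ball. Qed.

(** Compactness gives a finite net at each scale [1/(n+1)]; the sequence runs through the centres of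
    all nets by decoding pairs (scale, position). *)
Lemma exists_dense_seq :
  exists q : nat -> X, forall x (e : K), 0 < e -> exists k, dist x (q k) < e.
Proof.
have [_ cpt _] := Hdist.
have net (n : nat) : exists s : seq X, forall x,
    exists2 c, c \in s & dist x c < n.+1%:R^-1.
  have [||F finF FT] := cpt X (fun c => [set x | dist x c < n.+1%:R^-1]).
  - by move=> c; exact: mopen_ball.
  - apply/seteqP; split=> // x _; exists x => //=.
    by rewrite dist_self invr_gt0 ltr0n.
  have [s Fs] := (finite_seqP F).1 finF; exists s => x.
  have [c Fc xc] : (\bigcup_(i in F) [set x | dist x i < n.+1%:R^-1]) x.
    by rewrite FT.
  by exists c => //; rewrite Fs in Fc.
have [s sP] := choice net.
(* [point] only fills the codes that name no centre. *)
exists (fun i => if unpickle i is Some (n, k) then nth point (s n) k else point).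
move=> x e /exists_natSinv_lt[n ne].
have [c cs xc] := sP n x.
exists (pickle (n, index c (s n))).
by rewrite pickleK nth_index// (lt_trans xc).
Qed.

(* By density of [q], [dist x y < r] iff [dist x (q k) + dist y (q k) < r] for
   some [k]; this is where separability is needed, the measurable structure on
   [X * X] being the product sigma-algebra. *)
Lemma measurable_dist : measurable_fun setT (fun z : X * X => dist z.1 z.2).
Proof.
have m1 c : measurable_fun setT (dist^~ c).
  apply: (measurability _ (RGenInftyO.measurableE K)).
  move=> _ [_ [r ->] <-]; rewrite setTI.
  rewrite (_ : _ @^-1` _ = [set x | dist x c < r]); first exact: measurable_dball.
  by apply/seteqP; split=> x /=; rewrite in_itv.
have [q qP] := exists_dense_seq.
apply: (measurability _ (RGenInftyO.measurableE K)).
move=> _ [_ [r ->] <-]; rewrite setTI.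
rewrite (_ : _ @^-1` _ =
  \bigcup_k [set z : X * X | dist z.1 (q k) + dist z.2 (q k) < r]); last first.
  apply/seteqP; split=> -[x y] /=; rewrite in_itv/=.
    move=> xyr; have e0 : 0 < (r - dist x y) / 2 by rewrite divr_gt0// subr_gt0.
    have [k yk] := qP y _ e0; exists k => //=.
    by have := dist_tri x y (q k); lra.
  by move=> [k _ /=]; have := dist_tri x (q k) y; rewrite (dist_sym (q k)); lra.
apply: bigcupT_measurable => k.
rewrite (_ : [set _ | _] = (fun z : X * X => dist z.1 (q k) + dist z.2 (q k)) @^-1`
  `]-oo, r[%classic); last by apply/seteqP; split=> z /=; rewrite in_itv.
rewrite -[X in measurable X]setTI.
apply: (@measurable_funD _ _ _ setT (fun z : X * X => dist z.1 (q k))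
  (fun z => dist z.2 (q k))) => //.
- exact: (measurableT_comp (m1 _) measurable_fst).
- exact: (measurableT_comp (m1 _) measurable_snd).
Qed.

(** The complement of the support is the union of the null balls among the countably many balls with
    centre [q k] and radius [1/(n+1)]; measurability and nullity both follow. *)
Lemma msupp_full (mu : {measure set X -> \bar K}) :
  measurable (msupp dist mu) /\ mu (~` msupp dist mu) = 0%E.
Proof.
have [q qP] := exists_dense_seq.
pose B (n k : nat) := [set x | dist x (q k) < n.+1%:R^-1].
pose N (n k : nat) := if mu (B n k) == 0%E then B n k else set0.
have mB n k : measurable (B n k) by exact: measurable_dball.
have mN n k : measurable (N n k) by rewrite /N; case: ifP.
have muN n k : mu (N n k) = 0%E.
  by rewrite /N; case: ifPn => [/eqP//|_]; exact: measure0.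
have suppE : ~` msupp dist mu = \bigcup_n \bigcup_k N n k.
  apply/seteqP; split=> x.
  - move=> /existsNP[e] /not_implyP[e0] /negP; rewrite -leNgt => muxe.
    (* A ball of radius below [e / 2] that contains [x] lies in the null ball of radius [e] about
       [x]. *)
    have e20 : 0 < e / 2 by rewrite divr_gt0.
    have [n ne] := exists_natSinv_lt e20.
    have [|k xk] := qP x n.+1%:R^-1; first by rewrite invr_gt0 ltr0n.
    exists n => //; exists k => //; rewrite /N ifT//.
    rewrite eq_le measure_ge0 andbT (le_trans _ muxe)//.
    apply: le_measure; rewrite ?inE//.
      rewrite (_ : [set _ | _] = [set y | dist y x < e]); first exact: measurable_dball.
      by apply/seteqP; split=> y /=; rewrite dist_sym.
    move=> y; rewrite /B/= => yk.
    move: (n.+1%:R^-1) ne xk yk => t ne xk yk.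
    by have := dist_tri x (q k) y; rewrite (dist_sym (q k)); lra.
  - move=> [n _ [k _]]; rewrite /N; case: ifPn => // /eqP mu0; rewrite /B/= => xk.
    move=> /(_ (n.+1%:R^-1 - dist x (q k))); rewrite subr_gt0 => /(_ xk).
    apply/negP; rewrite -leNgt -mu0; apply: le_measure; rewrite ?inE//.
      rewrite (_ : [set _ | _] = [set y | dist y x < n.+1%:R^-1 - dist x (q k)]).
        exact: measurable_dball.
      by apply/seteqP; split=> y /=; rewrite dist_sym.
    move=> y; rewrite /B/= => xy.
    move: (n.+1%:R^-1) xy => t xy.
    by have := dist_tri y x (q k); rewrite (dist_sym y x); lra.
have mU : measurable (\bigcup_n \bigcup_k N n k).
  by apply: bigcupT_measurable => n; exact: bigcupT_measurable.
split; first by rewrite -(setCK (msupp _ _)) suppE; exact: measurableC.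
rewrite suppE; apply: measure_negligible => //; apply: negligible_bigcup => n.
apply: negligible_bigcup => k; apply/negligibleP; first exact: mN.
exact: muN.
Qed.

(** Each anchor gets the supremum of the radii at most 1 whose ball stays in [U]; the cap keeps it
    finite when [U] is the whole space. Only support points are reached, as the anchors are dense
    only there. *)
Lemma anchor_radii (mu : set X -> \bar K) (a : nat -> X) (U : set X) :
  anchors_dense dist mu a -> mopen dist U ->
  exists rad : nat -> K, (forall r x, dist x (a r) < rad r -> U x) /\
    (forall x, msupp dist mu x -> U x -> exists r, dist x (a r) < rad r).
Proof.
move=> [_ adense] oU.
pose E r := [set e : K | e <= 1 /\ forall x, dist x (a r) < e -> U x].
have ubE r : ubound (E r) 1 by move=> e [].
exists (fun r => sup (E r)); split=> [r x xr|x xs Ux].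
  have d0 : 0 <= dist x (a r) by have [[+ _ _ _] _ _] := Hdist; exact.
  have supE : has_sup (E r).
    split; last by exists 1.
    (* The supremum of the empty set is 0, which cannot exceed a distance. *)
    apply/set0P/negP => /eqP E0; move: xr; rewrite E0 sup0; lra.
  have [|e [_ eU] xe] := @sup_adherent _ (E r) (sup (E r) - dist x (a r)) _ supE.
    by rewrite subr_gt0.
  by apply: eU; lra.
have [e e0 eU] := oU x Ux.
pose f := Num.min e 1.
have f0 : 0 < f by rewrite lt_min e0/=.
have fe : f <= e by rewrite ge_min lexx.
have f1 : f <= 1 by rewrite ge_min lexx orbT.
(* An anchor within [f / 2] of [x] has its [f / 2]-ball inside the [f]-ball of [x], so [f / 2]
   belongs to [E r]. *)
have f20 : 0 < f / 2 by rewrite divr_gt0.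
have [r xr] := adense x xs _ f20.
exists r; apply: (lt_le_trans xr); apply: sup_upper_bound.
  split; last by exists 1.
  exists 0; split=> // y; have [[/(_ y (a r)) + _ _ _] _ _] := Hdist; lra.
split=> [|y yr]; first by lra.
by apply: eU; have := dist_tri x (a r) y; rewrite (dist_sym (a r)); lra.
Qed.

End compact_metric.

(** * Pushforwards and iterated product measures *)

Lemma pushforward_probability {K : realType} {d1 d2 : measure_display}
    {T1 : measurableType d1} {T2 : measurableType d2} {f : T1 -> T2}
    (P : probability T1 K) :
  measurable_fun setT f ->
  exists Q : probability T2 K, (Q : set T2 -> \bar K) = pushforward P f.
Proof. by move=> mf; exists (distribution P (mfun_Sub (mem_set mf))). Qed.

(** An integral depends only on the values of the measure on measurable sets, so the conclusion
    covers all sets. It identifies the array laws of joinings that agree on measurable sets. *)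
Lemma iprod_ext {K : realType} {d : measure_display} {T : measurableType d}
    (l1 l2 : {measure set T -> \bar K}) (n : nat) :
  (forall A, measurable A -> l1 A = l2 A) -> iprod l1 n = iprod l2 n.
Proof.
move=> l12; elim: n => [//|n IH]; apply/funext => A /=.
by rewrite IH; apply: eq_measure_integral => B mB _; exact: l12.
Qed.

(** The binary product measure is itself the integral of the sections, so each step of the recursion
    is the pushforward of such a product along consing. *)
Lemma iprod_probability {K : realType} {d : measure_display}
    {T : measurableType d} (P : probability T K) (n : nat) :
  exists Q : probability (n.-tuple T) K,
    forall A, measurable A -> iprod P n A = Q A.
Proof.
elim: n => [|n [Q IH]].
  exists (\d_([tuple] : 0.-tuple T)) => A mA /=; rewrite diracE.
  case: asboolP => h; first by rewrite mem_set.
  by rewrite memNset.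
pose c (z : T * n.-tuple T) : n.+1.-tuple T := [tuple of z.1 :: z.2].
have mc : measurable_fun setT c.
  by apply: measurable_cons; [exact: measurable_fst|exact: measurable_snd].
have [Q' Q'E] := pushforward_probability (P \x Q)%E mc.
exists Q' => A mA; rewrite Q'E /pushforward /product_measure1/=.
have mcA : measurable (c @^-1` A) by rewrite -[X in measurable X]setTI; exact: mc.
apply: eq_integral => x _ /=.
have secE : [set t : n.-tuple T | A [tuple of x :: t]] = xsection (c @^-1` A) x.
  by apply/seteqP; split=> t; rewrite /xsection/= inE.
by rewrite secE IH//; exact: measurable_xsection.
Qed.

(** * The Euclidean distance on arrays and the Wasserstein distance *)

Lemma euclid_self {K : realType} {N : nat} (x : N.-tuple K) : euclid x x = 0.
Proof. by rewrite /euclid big1 ?sqrtr0// => k _; rewrite subrr expr0n. Qed.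

Lemma euclid_ge0 {K : realType} {N : nat} (x y : N.-tuple K) : 0 <= euclid x y.
Proof. exact: sqrtr_ge0. Qed.

Lemma euclidC {K : realType} {N : nat} (x y : N.-tuple K) :
  euclid x y = euclid y x.
Proof.
by rewrite /euclid; congr Num.sqrt; apply: eq_bigr => k _; rewrite -sqrrN opprB.
Qed.

Lemma ler_euclid {K : realType} {N : nat} (x y : N.-tuple K) (k : 'I_N) :
  `|tnth x k - tnth y k| <= euclid x y.
Proof.
rewrite -sqrtr_sqr ler_wsqrtr// (bigD1 k)//= lerDl.
by apply: sumr_ge0 => i _; exact: sqr_ge0.
Qed.

Lemma measurable_euclid_powR {K : realType} (N : nat) (p : K) :
  measurable_fun setT (fun z : N.-tuple K * N.-tuple K => powR (euclid z.1 z.2) p).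
Proof.
apply: (measurableT_comp (measurable_powR p)).
apply: (measurableT_comp (continuous_measurable_fun (@sqrt_continuous K))).
apply: measurable_sum => k; apply: measurable_funX; apply: measurable_funB.
- exact: (measurableT_comp (measurable_tnth k) measurable_fst).
- exact: (measurableT_comp (measurable_tnth k) measurable_snd).
Qed.

(** The pushforward of [Q] along the diagonal is a coupling of cost zero. Both powers of 0, by [p]
    and by [p^-1], vanish because [p != 0]. *)
Lemma Wasserstein_self {K : realType} {N : nat} (p : K)
    (P : set (N.-tuple K) -> \bar K) (Q : probability (N.-tuple K) K) :
  p != 0 -> (forall A, measurable A -> P A = Q A) -> Wasserstein p P P = 0%E.
Proof.
move=> p0 PQ; rewrite /Wasserstein (_ : ereal_inf _ = 0%E) ?poweR0r ?invr_eq0//.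
apply/eqP; rewrite eq_le; apply/andP; split; last first.
  apply: le_ereal_inf_tmp => _ [pi _ <-].
  by apply: integral_ge0 => z _; rewrite lee_fin powR_ge0.
have mD : measurable_fun setT (fun x : N.-tuple K => (x, x)).
  exact: measurable_fun_pair.
have [pi piE] := pushforward_probability Q mD.
apply: ereal_inf_lbound; exists pi.
  split=> A mA; rewrite /= piE PQ// /pushforward; congr (Q _); apply/seteqP; split=> x //=.
    by case.
  by case.
rewrite /= piE ge0_integral_pushforward//.
- by apply: integral0_eq => x _ /=; rewrite euclid_self powR0.
- exact: (measurableT_comp (@EFin_measurable K setT) (measurable_euclid_powR N p)).
- by move=> z _; rewrite lee_fin powR_ge0.
Qed.

(** * Measurability of the distance arrays *)

Lemma measurable_iter {d : measure_display} {T : measurableType d} (f : T -> T)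
    (n : nat) : measurable_fun setT f -> measurable_fun setT (iter n f).
Proof.
move=> mf; elim: n => [|n IH]; first exact: measurable_id.
exact: (measurableT_comp mf IH).
Qed.

Lemma measurable_arr_entry {K : realType} {d dz : measure_display}
    {X : measurableType d} {Z : measurableType dz} (dist : X -> X -> K)
    (T : X -> X) (a : nat -> X) (n m R : nat) (x : Z -> 'I_n -> X)
    (k : arr_idx n m R) :
  compact_metric_borel dist -> measurable_fun setT T ->
  (forall i, measurable_fun setT (x^~ i)) ->
  measurable_fun setT (fun z => arr_entry dist T a n m R (x z) k).
Proof.
move=> Hd mT mx.
have mix i j : measurable_fun setT (fun z => iter j T (x z i)).
  exact: (measurableT_comp (measurable_iter T j mT) (mx i)).
case: k => [[[[i j] s] t]|[[i s] r]] /=.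
- by apply: (measurableT_comp (measurable_dist _ _ _ dist Hd)
    (measurable_fun_pair _ _)); exact: mix.
- by apply: (measurableT_comp (measurable_dist _ _ _ dist Hd)
    (measurable_fun_pair _ _)); [exact: mix|exact: measurable_cst].
Qed.

Lemma measurable_Dtilde {K : realType} {dx dy : measure_display}
    {X : measurableType dx} {Y : measurableType dy} (dX : X -> X -> K)
    (dY : Y -> Y -> K) (T : X -> X) (S : Y -> Y) (a : nat -> X) (b : nat -> Y)
    (n m R : nat) :
  compact_metric_borel dX -> compact_metric_borel dY ->
  measurable_fun setT T -> measurable_fun setT S ->
  measurable_fun setT (Dtilde dX dY T S a b n m R).
Proof.
move=> HX HY mT mS; apply/measurable_fun_tnthP => k.
rewrite /Dtilde /comp; under eq_fun do rewrite tnth_mktuple.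
case: (enum_val k) => e.
- apply: measurable_arr_entry => // i.
  exact: (measurableT_comp measurable_fst (measurable_tnth i)).
- apply: measurable_arr_entry => // i.
  exact: (measurableT_comp measurable_snd (measurable_tnth i)).
Qed.

(** * Consequences of a zero Wasserstein distance *)

(* Markov's inequality: a coupling of cost at most [e] moves mass at most
   [e / delta^p] over a distance at least [delta]. *)
Lemma Wasserstein0_le {K : realType} {N : nat} (p : K)
    (P Q : set (N.-tuple K) -> \bar K) (A B : set (N.-tuple K)) (delta : K) :
  1 <= p -> Wasserstein p P Q = 0%E -> measurable A -> measurable B ->
  0 < delta -> (forall u w, A u -> euclid u w < delta -> B w) ->
  (P A <= Q B)%E /\ (Q A <= P B)%E.
Proof.
move=> p1 W0 mA mB delta0 AB; have p0 : 0 < p by exact: lt_le_trans p1.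
have dp0 : 0 < powR delta p by exact: powR_gt0.
pose cost (z : N.-tuple K * N.-tuple K) := powR (euclid z.1 z.2) p.
have mcost : measurable_fun setT (EFin \o cost).
  exact: (measurableT_comp (@EFin_measurable K setT) (measurable_euclid_powR N p)).
pose far := [set z | powR delta p <= cost z].
have mfar : measurable far.
  rewrite (_ : far = setT `&` cost @^-1` `[powR delta p, +oo[%classic).
    exact: measurable_euclid_powR.
  by rewrite setTI; apply/seteqP; split=> z; rewrite /far/= in_itv/= andbT.
pose I := [set (\int[pi]_z (cost z)%:E)%E
  | pi in [set pi : {measure set (N.-tuple K * N.-tuple K) -> \bar K} | coupling P Q pi]].
have I0 : ereal_inf I = 0%E.
  apply: (@poweR_eq0_eq0 _ _ p^-1) => //.
  by apply: le_ereal_inf_tmp => _ [pi _ <-]; apply: integral_ge0 => z _; rewrite lee_fin powR_ge0.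
(* The infimum need not be attained, so a coupling of cost below [delta^p * e] is taken. *)
have near e : 0 < e -> exists pi : {measure set (N.-tuple K * N.-tuple K) -> \bar K},
    coupling P Q pi /\ (pi far <= e%:E)%E.
  move=> e0; have : (ereal_inf I < (powR delta p * e)%:E)%E.
    by rewrite I0 lte_fin mulr_gt0.
  move=> /ereal_inf_lt[_ [pi cpi <-]] lt_e; exists pi; split=> //.
  rewrite -(@lee_pmul2l _ (powR delta p)%:E)// -EFinM (le_trans _ (ltW lt_e))//.
  have := @le_integral_comp_abse _ _ _ pi setT measurableT (EFin \o cost)
    (powR delta p) id (@measurable_id _ _ setT) _ _ mcost dp0.
  rewrite setTI (_ : [set x | _] = far); last first.
    by apply/seteqP; split=> z; rewrite /far/= ger0_norm ?powR_ge0 ?lee_fin.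
  under eq_integral do rewrite /= ger0_norm ?powR_ge0//.
  by apply.
have farP z : ~ far z -> euclid z.1 z.2 < delta.
  move=> /negP; rewrite -ltNge /cost => h; rewrite ltNge; apply/negP => h'.
  by move: h; rewrite ltNge ge0_ler_powR// ?nnegrE ?euclid_ge0 ?ltW.
(* Off [far], one entry in [A] puts the other in [B]; either order works because [euclid] is
   symmetric. *)
split; apply/lee_addgt0Pr => e /near[pi [[piP piQ] pifar]].
- rewrite -piP// -piQ// (le_trans _ (leeD2l _ pifar))//.
  have mTB : measurable ([set: N.-tuple K] `*` B) by exact: measurableX.
  have mAT : measurable (A `*` [set: N.-tuple K]) by exact: measurableX.
  apply: (le_trans _ (measureU2 _ mTB mfar)).
  apply: le_measure; rewrite ?inE//; first exact: measurableU.
  move=> z [Az _]; have [?|/farP zd] := pselect (far z); first by right.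
  by left; split=> //; exact: AB zd.
- rewrite -piP// -piQ// (le_trans _ (leeD2l _ pifar))//.
  have mTA : measurable ([set: N.-tuple K] `*` A) by exact: measurableX.
  have mBT : measurable (B `*` [set: N.-tuple K]) by exact: measurableX.
  apply: (le_trans _ (measureU2 _ mBT mfar)).
  apply: le_measure; rewrite ?inE//; first exact: measurableU.
  move=> z [_ Az]; have [?|/farP zd] := pselect (far z); first by right.
  by left; split=> //; apply: (AB _ _ Az); rewrite euclidC.
Qed.

(** * One-point laws, product joinings and open rectangles *)

Lemma Phi1E {K : realType} {dx dy : measure_display}
    {X : measurableType dx} {Y : measurableType dy} (dX : X -> X -> K)
    (dY : Y -> Y -> K) (T : X -> X) (S : Y -> Y) (a : nat -> X) (b : nat -> Y)
    (m R : nat) (lam : {measure set (X * Y) -> \bar K}) (A : set (cube K 1 m R)) :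
  let E := [set z | A (Dtilde dX dY T S a b 1 m R [tuple z])] in
  measurable E -> Phi dX dY T S a b 1 m R lam A = lam E.
Proof.
move=> E mE; transitivity (\int[lam]_z (\1_E z)%:E)%E; last by rewrite integral_indic// setIT.
rewrite /Phi /=; apply: eq_integral => z _; rewrite indicE.
have tE : [tuple of z :: [tuple]] = [tuple z] by exact: val_inj.
case: asboolP => /=; rewrite tE => h; first by rewrite mem_set.
by rewrite memNset.
Qed.

(** Invariance comes from uniqueness of the product measure: the image of [mu \x nu] under the
    product map has the right values on rectangles. *)
Lemma joining_product {K : realType} {dx dy : measure_display}
    {X : measurableType dx} {Y : measurableType dy}
    (mu : probability X K) (nu : probability Y K) (T : X -> X) (S : Y -> Y) :
  mpreserving mu T -> mpreserving nu S -> joining mu nu T S (mu \x nu)%E.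
Proof.
move=> [mT muT] [mS nuS]; split=> [A mA|B mB|C mC].
- by rewrite product_measure1E// [X in (_ * X)%E]probability_setT mule1.
- by rewrite product_measure1E// [X in (X * _)%E]probability_setT mul1e.
have mTS : measurable_fun setT (fun z : X * Y => (T z.1, S z.2)).
  apply: measurable_fun_pair.
    exact: (measurableT_comp mT measurable_fst).
  exact: (measurableT_comp mS measurable_snd).
have [Q QE] := pushforward_probability (mu \x nu)%E mTS.
rewrite -[LHS]/(pushforward (mu \x nu)%E (fun z : X * Y => (T z.1, S z.2)) C) -QE.
apply/esym; apply: product_measure_unique => // A B mA mB.
rewrite /= QE /pushforward (_ : _ @^-1` _ = (T @^-1` A) `*` (S @^-1` B))//.
rewrite [LHS]product_measure1E; first by congr (_ * _)%E; [exact: muT|exact: nuS].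
  by rewrite -[X in measurable X]setTI; exact: mT.
by rewrite -[X in measurable X]setTI; exact: mS.
Qed.

(** Open rectangles are stable under intersection and generate the product sigma-algebra, so they
    determine a finite measure. *)
Lemma measure_eq_open_rectangles {K : realType} {dx dy : measure_display}
    {X : measurableType dx} {Y : measurableType dy} (dX : X -> X -> K)
    (dY : Y -> Y -> K) (l1 l2 : {measure set (X * Y) -> \bar K}) :
  compact_metric_borel dX -> compact_metric_borel dY ->
  (l1 setT < +oo)%E ->
  (forall U W, mopen dX U -> mopen dY W -> l1 (U `*` W) = l2 (U `*` W)) ->
  forall C, measurable C -> l1 C = l2 C.
Proof.
move=> HX HY fin1 eqUW.
have oT (d : measure_display) (Z : measurableType d) (dist : Z -> Z -> K) :
  mopen dist setT by move=> z _; exists 1.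
have oI (d : measure_display) (Z : measurableType d) (dist : Z -> Z -> K) A B :
    mopen dist A -> mopen dist B -> mopen dist (A `&` B).
  move=> oA oB z [/oA[e e0 eA] /oB[f f0 fB]]; exists (Num.min e f).
    by rewrite lt_min e0.
  by move=> y; rewrite lt_min => /andP[/eA ? /fB ?].
pose G := [set U `*` W | U in mopen dX & W in mopen dY].
have GE : @measurable _ (X * Y)%type = <<s G >>.
  apply/seteqP; split; last first.
    apply: smallest_sub; first exact: sigma_algebra_measurable.
    move=> _ [U oU [W oW <-]].
    by apply: measurableX; [exact: (mopen_measurable _ _ _ _ HX)
                           |exact: (mopen_measurable _ _ _ _ HY)].
  rewrite measurable_prod_measurableType.
  apply: smallest_sub; first exact: smallest_sigma_algebra.
  move=> _ [A mA [B mB <-]].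
  (* On [Z] both projections are measurable, since an open set pulls back to an open rectangle with
     one full side; a measurable rectangle is the intersection of two such preimages. *)
  pose Z := g_sigma_algebraType G.
  have m1 : measurable_fun setT (fst : Z -> X).
    apply: (measurability [set U | mopen dX U]).
      by have [_ _ borel] := HX; apply/seteqP; split=> D /borel.
    move=> _ [U oU <-]; apply: sub_sigma_algebra; exists U => //.
    exists setT; first exact: oT.
    by change (U `*` setT = [set: X * Y] `&` fst @^-1` U); rewrite setTI;
      apply/seteqP; split=> z //= -[].
  have m2 : measurable_fun setT (snd : Z -> Y).
    apply: (measurability [set U | mopen dY U]).
      by have [_ _ borel] := HY; apply/seteqP; split=> D /borel.
    move=> _ [W oW <-]; apply: sub_sigma_algebra; exists setT; first exact: oT.
    by exists W.
  have : @measurable _ Z ((setT `&` fst @^-1` A) `&` (setT `&` snd @^-1` B)).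
    by apply: measurableI; [exact: m1|exact: m2].
  by rewrite !setTI.
apply: (measure_unique G (fun=> setT) GE).
- move=> _ _ [U oU [W oW <-]] [U' oU' [W' oW' <-]].
  by exists (U `&` U'); [exact: oI|exists (W `&` W'); [exact: oI|rewrite setXI]].
- by move=> _; exists setT; [exact: oT|exists setT; [exact: oT|rewrite setXTT]].
- by rewrite bigcup_const.
- by move=> _ [U oU [W oW <-]]; exact: eqUW.
- by [].
Qed.

(** * Recovering a joining from anchor distances *)

Section anchored_rectangles.
Context {K : realType} {dx dy : measure_display}
    {X : measurableType dx} {Y : measurableType dy}
    (dX : X -> X -> K) (dY : Y -> Y -> K)
    (mu : probability X K) (nu : probability Y K)
    (T : X -> X) (S : Y -> Y) (a : nat -> X) (b : nat -> Y) (p : K).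
Hypotheses (HX : compact_metric_borel dX) (HY : compact_metric_borel dY).
Hypotheses (Ha : anchors_dense dX mu a) (Hb : anchors_dense dY nu b).
Hypothesis p1 : 1 <= p.

(** Used with two margins: [s = 0] keeps the set inside the open set the radii come from, and
    [s = 1/(k+1)] leaves room for a smaller error in each distance. Tying the margin to [k] gives
    one increasing sequence that exhausts all anchor balls. *)
Let near {d : measure_display} {Z : measurableType d} (dist : Z -> Z -> K)
    (c : nat -> Z) (rad : nat -> K) (s : K) (k : nat) :=
  [set z | exists r : 'I_k.+1, dist z (c r) + s < rad r].

Let measurable_near {d : measure_display} {Z : measurableType d}
    (dist : Z -> Z -> K) c rad s k :
  compact_metric_borel dist -> measurable (near dist c rad s k).
Proof.
move=> HZ; rewrite (_ : near _ _ _ _ _ =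
    \bigcup_(r in [set: 'I_k.+1]) [set z | dist z (c r) < rad r - s]).
  apply: fin_bigcup_measurable => // r _; exact: measurable_dball.
apply/seteqP; split=> z [r]; first by exists r => //=; rewrite ltrBrDr.
by move=> _ /=; rewrite ltrBrDr => ?; exists r.
Qed.

Let near_mono {d : measure_display} {Z : measurableType d} (dist : Z -> Z -> K)
    c rad k l : (k <= l)%N ->
  near dist c rad k.+1%:R^-1 k `<=` near dist c rad l.+1%:R^-1 l.
Proof.
move=> kl z [r zr]; exists (widen_ord (kl : (k.+1 <= l.+1)%N) r).
by apply: le_lt_trans zr => /=; rewrite lerD2l lef_pV2 ?posrE ?ltr0n ?ler_nat.
Qed.

Let near_exhaust {d : measure_display} {Z : measurableType d}
    (dist : Z -> Z -> K) c rad r z :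
  dist z (c r) < rad r ->
  exists N, forall k, (N <= k)%N -> near dist c rad k.+1%:R^-1 k z.
Proof.
rewrite -subr_gt0 => /exists_natSinv_lt[n ne].
(* [n <= k] makes the margin smaller than the slack at [z], and [r <= k] puts anchor [r] among the
   first [k+1]. *)
exists (maxn n r) => k; rewrite geq_max => /andP[nk rk].
exists (Ordinal (rk : (r < k.+1)%N)) => /=.
rewrite -ltrBrDl; apply: le_lt_trans ne.
by rewrite lef_pV2 ?posrE ?ltr0n ?ler_nat.
Qed.

(** For [n = m = 1] the anchor block lists the distances to the anchors from the point itself, at
    time 0. *)
Let eX (k : nat) (r : 'I_k.+1) : 'I_#|pair_idx 1 1 k.+1| :=
  enum_rank (inl (inr (ord0, ord0, r)) : pair_idx 1 1 k.+1).

Let eY (k : nat) (r : 'I_k.+1) : 'I_#|pair_idx 1 1 k.+1| :=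
  enum_rank (inr (inr (ord0, ord0, r)) : pair_idx 1 1 k.+1).

(** The event on arrays that pulls back to a rectangle of two [near] sets. *)
Let box (radX radY : nat -> K) (s : K) (k : nat) : set (cube K 1 1 k.+1) :=
  [set u | (exists r, tnth u (eX k r) + s < radX r) /\
           (exists r, tnth u (eY k r) + s < radY r)].

Let measurable_box radX radY s k : measurable (box radX radY s k).
Proof.
have mcoord (e : 'I_k.+1 -> 'I_#|pair_idx 1 1 k.+1|) (rad : nat -> K) :
    measurable [set u : cube K 1 1 k.+1 | exists r, tnth u (e r) + s < rad r].
  rewrite (_ : [set _ | _] = \bigcup_(r in [set: 'I_k.+1])
      (setT `&` (fun u : cube K 1 1 k.+1 => tnth u (e r)) @^-1` `]-oo, rad r - s[%classic)).
    by apply: fin_bigcup_measurable => // r _; exact: measurable_tnth.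
  apply/seteqP; split=> u [r].
    by exists r => //=; rewrite in_itv/= ltrBrDr.
  by move=> _ [_]; rewrite /= in_itv/= ltrBrDr => ?; exists r.
exact: (measurableI _ _ (mcoord (eX k) radX) (mcoord (eY k) radY)).
Qed.

Let Phi_box (l : {measure set (X * Y) -> \bar K}) radX radY s k :
  Phi dX dY T S a b 1 1 k.+1 l (box radX radY s k) =
  l (near dX a radX s k `*` near dY b radY s k).
Proof.
have E : [set z | box radX radY s k (Dtilde dX dY T S a b 1 1 k.+1 [tuple z])] =
    near dX a radX s k `*` near dY b radY s k.
  apply/seteqP; split=> z [[r zr] [t zt]].
    move: zr zt; rewrite /Dtilde !tnth_mktuple !enum_rankK /= => zr zt.
    by split; [exists r|exists t].
  by split; [exists r|exists t]; rewrite /Dtilde !tnth_mktuple !enum_rankK.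
rewrite Phi1E ?E//.
by apply: measurableX; exact: measurable_near.
Qed.

(** Up to an [l]-null set, the shrunk rectangles increase to the open one. Each is compared with the
    [l']-mass of a rectangle still inside the open one, and continuity from below concludes. *)
Let joining_rectangle_le (l l' : {measure set (X * Y) -> \bar K}) U W radX radY :
  joining mu nu T S l ->
  mopen dX U -> mopen dY W ->
  (forall r x, dX x (a r) < radX r -> U x) ->
  (forall r y, dY y (b r) < radY r -> W y) ->
  (forall x, msupp dX mu x -> U x -> exists r, dX x (a r) < radX r) ->
  (forall y, msupp dY nu y -> W y -> exists r, dY y (b r) < radY r) ->
  (forall k, l (near dX a radX k.+1%:R^-1 k `*` near dY b radY k.+1%:R^-1 k) <=
             l' (near dX a radX 0 k `*` near dY b radY 0 k))%E ->
  (l (U `*` W) <= l' (U `*` W))%E.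
Proof.
move=> [lX lY _] oU oW UX WY XU YW le_k.
have mUW : measurable (U `*` W).
  by apply: measurableX; [exact: (mopen_measurable _ _ _ _ HX)
                         |exact: (mopen_measurable _ _ _ _ HY)].
pose F k := near dX a radX k.+1%:R^-1 k `*` near dY b radY k.+1%:R^-1 k.
have mF k : measurable (F k) by apply: measurableX; exact: measurable_near.
have mUF : measurable (\bigcup_k F k) by exact: bigcupT_measurable.
have [msX muX] := msupp_full _ _ _ _ HX mu.
have [msY nuY] := msupp_full _ _ _ _ HY nu.
have mNX : measurable ((~` msupp dX mu) `*` [set: Y]).
  by apply: measurableX => //; exact: measurableC.
have mNY : measurable ([set: X] `*` (~` msupp dY nu)).
  by apply: measurableX => //; exact: measurableC.
have NX0 : l ((~` msupp dX mu) `*` [set: Y]) = 0%E.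
  by rewrite lX//; exact: measurableC.
have NY0 : l ([set: X] `*` (~` msupp dY nu)) = 0%E.
  by rewrite lY//; exact: measurableC.
(* Points missed by the union lie over the complement of a support, a null set because [l] has
   marginals [mu] and [nu]. *)
have UWF : (l (U `*` W) <= l (\bigcup_k F k))%E.
  rewrite -(measureU0 mUF mNX NX0) -(measureU0 (measurableU _ _ mUF mNX) mNY NY0).
  apply: le_measure; rewrite ?inE//.
    by apply: measurableU => //; exact: measurableU.
  move=> -[x y] [Ux Wy].
  have [sx|nsx] := pselect (msupp dX mu x); last by left; right.
  have [sy|nsy] := pselect (msupp dY nu y); last by right.
  left; left.
  have [r xr] := XU x sx Ux; have [N HN] := near_exhaust dX a radX r x xr.
  have [t yt] := YW y sy Wy; have [M HM] := near_exhaust dY b radY t y yt.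
  exists (maxn N M) => //; split=> /=.
    by apply: HN; rewrite leq_maxl.
  by apply: HM; rewrite leq_maxr.
apply: (le_trans UWF).
have cvgF : (l \o F) k @[k --> \oo] --> l (\bigcup_k F k).
  apply: nondecreasing_cvg_mu => // k k' kk'; apply/subsetPset.
  by move=> z [zx zy]; split; [exact: (near_mono dX a radX k k' kk')|
    exact: (near_mono dY b radY k k' kk')].
rewrite -(cvg_lim _ cvgF)//; apply: lime_le; first by apply/cvg_ex; eexists; exact: cvgF.
apply: nearW => k /=; apply: (le_trans (le_k k)).
apply: le_measure; rewrite ?inE//.
  by apply: measurableX; exact: measurable_near.
move=> z [[r +] [t +]]; rewrite !addr0 => zr zt.
by split; [exact: UX zr|exact: WY zt].
Qed.

Lemma Wasserstein0_eq_joinings (l l' : {measure set (X * Y) -> \bar K}) :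
  joining mu nu T S l -> joining mu nu T S l' ->
  (forall R, (0 < R)%N -> Wasserstein p (Phi dX dY T S a b 1 1 R l)
                                        (Phi dX dY T S a b 1 1 R l') = 0%E) ->
  forall C, measurable C -> l C = l' C.
Proof.
move=> jl jl' W0; apply: (measure_eq_open_rectangles dX dY _ _ HX HY).
  by have [lX _ _] := jl; rewrite -setXTT lX// probability_setT ltry.
move=> U W oU oW.
have [radX [UX XU]] := anchor_radii _ _ _ _ HX mu a U Ha oU.
have [radY [WY YW]] := anchor_radii _ _ _ _ HY nu b W Hb oW.
have le_k k := Wasserstein0_le p _ _ (box radX radY k.+1%:R^-1 k)
  (box radX radY 0 k) k.+1%:R^-1 p1 (W0 k.+1 isT) (measurable_box _ _ _ _)
  (measurable_box _ _ _ _).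
have {}le_k k : (l (near dX a radX k.+1%:R^-1 k `*` near dY b radY k.+1%:R^-1 k) <=
      l' (near dX a radX 0 k `*` near dY b radY 0 k))%E /\
    (l' (near dX a radX k.+1%:R^-1 k `*` near dY b radY k.+1%:R^-1 k) <=
      l (near dX a radX 0 k `*` near dY b radY 0 k))%E.
  rewrite -!Phi_box; apply: le_k; first by rewrite invr_gt0 ltr0n.
  (* Arrays closer than [1/(k+1)] differ by less than the margin in every coordinate. *)
  move=> u w [[r ur] [t ut]] uw.
  have close i : tnth w i < tnth u i + k.+1%:R^-1.
    have := le_lt_trans (ler_euclid u w i) uw.
    by rewrite ltr_distlC => /andP[].
  split; [exists r|exists t]; rewrite addr0.
    exact: lt_trans (close _) ur.
  exact: lt_trans (close _) ut.
apply/eqP; rewrite eq_le; apply/andP; split.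
- by apply: (joining_rectangle_le l l' U W radX radY) => // k; have [] := le_k k.
- by apply: (joining_rectangle_le l' l U W radX radY) => // k; have [] := le_k k.
Qed.

End anchored_rectangles.

Theorem theorem17 (K : realType) (dx dy : measure_display)
    (X : measurableType dx) (Y : measurableType dy)
    (dX : X -> X -> K) (dY : Y -> Y -> K)
    (mu : probability X K) (nu : probability Y K)
    (T : X -> X) (S : Y -> Y) (a : nat -> X) (b : nat -> Y) (p : K) :
  compact_metric_borel dX -> compact_metric_borel dY ->
  mpreserving mu T -> mpreserving nu S ->
  anchors_dense dX mu a -> anchors_dense dY nu b ->
  1 <= p ->
  (forall n m R : nat, (0 < n)%N -> (0 < m)%N -> (0 < R)%N ->
     Dep dX dY mu nu T S a b n m R p = 0%E)
  <-> disjoint_systems mu nu T S.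
Proof.
move=> HX HY HT HS Ha Hb p1.
have p0 : p != 0 by rewrite gt_eqF// (lt_le_trans ltr01).
have jprod := joining_product mu nu T S HT HS.
split=> [Dep0|[_ disj] n m R n0 m0 R0].
- split=> // lam jlam.
  apply: (Wasserstein0_eq_joinings dX dY mu nu T S a b p HX HY
    Ha Hb p1 _ _ jlam jprod).
  move=> R R0; apply/eqP; rewrite eq_le poweR_ge0 andbT.
  by rewrite -(Dep0 1%N 1%N R)// /Dep; apply: ereal_sup_ubound; exists lam.
- have [Q QE] := iprod_probability (mu \x nu)%E n.
  have mD : measurable_fun setT (Dtilde dX dY T S a b n m R).
    by apply: measurable_Dtilde => //; [exact: HT.1|exact: HS.1].
  have [P PE] := pushforward_probability Q mD.
  have W0 : Wasserstein p (Phi dX dY T S a b n m R (mu \x nu)%E)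
                          (Phi dX dY T S a b n m R (mu \x nu)%E) = 0%E.
    apply: (Wasserstein_self p _ P) => // A mA.
    rewrite PE /pushforward /Phi QE// -[X in measurable X]setTI; exact: mD.
  have Wlam (lam : {measure set (X * Y) -> \bar K}) : joining mu nu T S lam ->
      Wasserstein p (Phi dX dY T S a b n m R lam)
                    (Phi dX dY T S a b n m R (mu \x nu)%E) = 0%E.
    (* By [disj] the two joinings agree on measurable sets, so their array laws are the same
       function. *)
    move=> jlam; rewrite -[RHS]W0; congr Wasserstein.
    by rewrite /Phi (iprod_ext lam (mu \x nu)%E)//; exact: disj.
  apply/eqP; rewrite eq_le; apply/andP; split.
    by apply: ge_ereal_sup => _ [lam jlam <-]; rewrite Wlam.
  (* The product joining attains the value 0; with no joining at all the supremum would be [-oo]. *)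
  by rewrite /Dep; apply: ereal_sup_ubound; exists (mu \x nu)%E.
Qed.
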